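(* Let $n\ge 2$, let $G=\langle a_1,\dots,a_n\rangle$ be free of rank $n$, and let $V_n$ be the set of endomorphisms of $G$ whose Wagner tails are all different. Let $$d_n=\prod_{k=1}^{n}\frac{4(n-1)^4-(8k-6)(n-1)^2+4k^2-6k+2}{n(n-1)(2n-1)^2}.$$ If the limit defining the asymptotic density $D(V_n)$ exists, then $D(V_n)\ge d_n$.
   Context: Wagner tails: let $\phi:G\to G$ be an endomorphism. For each $i$ and each occurrence of a letter $a_i^{\epsilon}$ ($\epsilon=\pm1$) in the reduced word $\phi(a_i)$, write the reduced product $\phi(a_i)=v a_i^{\epsilon}\overline v$. This occurrence gives two Wagner tails: $w=v$ and $\overline w=\overline v^{-1}$ if $\epsilon=1$; $w=va_i^{-1}$ and $\overline w=\overline v^{-1}a_i$ if $\epsilon=-1$. In addition the wedge point (base point) has tails $w=\overline w=1$. The Wagner tails are ''all different'' if all these words (over all $i$ and all occurrences) are pairwise distinct elements of $G$ and different from $1$ (i.e. the only repetition is the repeated word $1$ at the wedge point). Density: let $G_p$ be the set of elements of $G$ of reduced word length at most $p$. An endomorphism $\phi$ is identified with $(\phi(a_1),\dots,\phi(a_n))\in G^n$. For a set $S\subset G^n$, $D(S)=\lim_{p\to\infty}\frac{|S\cap G_p^n|}{|G_p^n|}$, where $G_p^n=(G_p)^n$. *)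

(* Defs.v *)
From HB Require Import structures.
From mathcomp Require Import all_boot all_order all_algebra finmap.
From mathcomp Require Import all_classical all_reals all_analysis.

Set Implicit Arguments.
Unset Strict Implicit.
Unset Printing Implicit Defensive.

Import Order.TTheory GRing.Theory Num.Theory.
Import numFieldNormedType.Exports.

Local Open Scope classical_set_scope.

(* (i, true) stands for a_i and (i, false) for a_i^-1; the generators are     *)
(* indexed by 'I_n, i.e. from 0.                                              *)
Notation letter n := ('I_n * bool)%type.

Definition linv n (x : letter n) : letter n := (x.1, ~~ x.2).

Definition reduced n (s : seq (letter n)) : bool :=
  sorted (fun x y => y != linv x) s.

Record free_group (n : nat) : Type :=
  FreeGroup { fword : seq (letter n); _ : reduced fword }.

HB.instance Definition _ n := [isSub for @fword n].
HB.instance Definition _ n := [Choice of free_group n by <:].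

Definition pcons n (x : letter n) (s : seq (letter n)) : seq (letter n) :=
  if s is y :: s' then if y == linv x then s' else x :: s else [:: x].

Definition reduce n (s : seq (letter n)) : seq (letter n) :=
  foldr (@pcons n) [::] s.

Lemma linvK n : involutive (@linv n).
Proof. by case=> i b; rewrite /linv /= negbK. Qed.

Lemma reduced_behead n x (s : seq (letter n)) : reduced (x :: s) -> reduced s.
Proof. exact: path_sorted. Qed.

Lemma pcons_reduced n x (s : seq (letter n)) : reduced s -> reduced (pcons x s).
Proof.
case: s => [|y s] //= rs; case: ifPn => [_|yx]; first exact: reduced_behead rs.
by rewrite /reduced /= yx.
Qed.

Lemma foldr_pcons_reduced n (s t : seq (letter n)) :
  reduced t -> reduced (foldr (@pcons n) t s).
Proof. by move=> rt; elim: s => //= x s IH; apply: pcons_reduced. Qed.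

Lemma reduce_reduced n (s : seq (letter n)) : reduced (reduce s).
Proof. exact: foldr_pcons_reduced. Qed.

Lemma pcons_id n x (s : seq (letter n)) : reduced (x :: s) -> pcons x s = x :: s.
Proof.
by case: s => [|y s] //=; rewrite /reduced /= => /andP[/negbTE-> _].
Qed.

Lemma reduceK n (s : seq (letter n)) : reduced s -> reduce s = s.
Proof.
elim: s => [|x s IH] //= rs; rewrite IH ?pcons_id//.
exact: reduced_behead rs.
Qed.

Lemma pconsK n x (s : seq (letter n)) :
  reduced s -> pcons (linv x) (pcons x s) = s.
Proof.
case: s => [|y s] /= rs; first by rewrite linvK eqxx.
case: ifP => [/eqP yE|_] /=; last by rewrite linvK eqxx.
by rewrite -yE pcons_id.
Qed.

Lemma pconsVK n x (s : seq (letter n)) :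
  reduced s -> pcons x (pcons (linv x) s) = s.
Proof. by move=> rs; rewrite -[x in pcons x]linvK pconsK. Qed.

Lemma foldr_pcons_reduce n (s t : seq (letter n)) :
  reduced t -> foldr (@pcons n) t (reduce s) = foldr (@pcons n) t s.
Proof.
move=> rt; elim: s => //= x s <-.
case: (reduce s) => //= y s'; case: ifP => //= /eqP->.
by rewrite pconsVK //; apply: foldr_pcons_reduced.
Qed.

Lemma reduce_catl n (s t : seq (letter n)) : reduce (reduce s ++ t) = reduce (s ++ t).
Proof. by rewrite /reduce !foldr_cat foldr_pcons_reduce ?reduce_reduced. Qed.

Lemma reduce_catr n (s t : seq (letter n)) : reduce (s ++ reduce t) = reduce (s ++ t).
Proof.
rewrite /reduce !foldr_cat; congr foldr.
exact: reduceK (reduce_reduced _).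
Qed.

Definition word_inv n (s : seq (letter n)) : seq (letter n) :=
  rev [seq linv x | x <- s].

Lemma word_invK n : involutive (@word_inv n).
Proof.
by move=> s; rewrite /word_inv map_rev revK -map_comp map_id_in// => x _ /=;
  rewrite linvK.
Qed.

Lemma reduce_invl n (s : seq (letter n)) : reduce (word_inv s ++ s) = [::].
Proof.
elim: s => // x s IH; rewrite /word_inv map_cons rev_cons cat_rcons.
by rewrite /reduce foldr_cat/= pconsK ?reduce_reduced// -foldr_cat.
Qed.

(* The element of the free group represented by a not necessarily reduced     *)
(* word.                                                                      *)
Definition of_word n (s : seq (letter n)) : free_group n :=
  FreeGroup (reduce_reduced s).

Lemma fword_reduced n (g : free_group n) : reduced (fword g).
Proof. exact: valP g. Qed.

Lemma of_wordK n (s : seq (letter n)) : reduced s -> fword (of_word s) = s.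
Proof. exact: reduceK. Qed.

Lemma fwordK n : cancel (@fword n) (@of_word n).
Proof. by move=> g; apply/val_inj/of_wordK/fword_reduced. Qed.

Definition fg_one n : free_group n := of_word [::].
Definition fg_inv n (g : free_group n) := of_word (word_inv (fword g)).
Definition fg_mul n (g h : free_group n) := of_word (fword g ++ fword h).

Fact fg_mulA n : associative (@fg_mul n).
Proof.
by move=> f g h; apply: val_inj; rewrite /= reduce_catl reduce_catr catA.
Qed.

Fact fg_mul1 n : left_id (@fg_one n) (@fg_mul n).
Proof. exact: fwordK. Qed.

Fact fg_mulr1 n : right_id (@fg_one n) (@fg_mul n).
Proof. by move=> g; rewrite /fg_mul cats0 fwordK. Qed.

Fact fg_mulV n : left_inverse (@fg_one n) (@fg_inv n) (@fg_mul n).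
Proof. by move=> g; apply: val_inj; rewrite /= reduce_catl reduce_invl. Qed.

Fact fg_mulrV n : right_inverse (@fg_one n) (@fg_inv n) (@fg_mul n).
Proof.
move=> g; apply: val_inj; rewrite /= reduce_catr -[X in X ++ _]word_invK.
exact: reduce_invl.
Qed.

HB.instance Definition _ n := isGroup.Build (free_group n)
  (@fg_mulA n) (@fg_mul1 n) (@fg_mulr1 n) (@fg_mulV n) (@fg_mulrV n).

Definition gen n (i : 'I_n) : free_group n := of_word [:: (i, true)].

Lemma of_word_cat n (s t : seq (letter n)) :
  of_word (s ++ t) = (of_word s * of_word t)%g.
Proof. by apply: val_inj; rewrite /= reduce_catl reduce_catr. Qed.

Lemma of_word1 n (x : letter n) :
  of_word [:: x] = if x.2 then gen x.1 else (gen x.1)^-1%g.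
Proof. by case: x => i []; apply: val_inj. Qed.

(* Universal property: an endomorphism is determined by an arbitrary n-tuple  *)
(* of images of the generators.                                               *)
Lemma free_group_ext n (H : groupType) (f g : {multiplicative free_group n -> H}) :
  (forall i, f (gen i) = g (gen i)) -> f =1 g.
Proof.
have h1 (h : {multiplicative free_group n -> H}) : h 1%g = 1%g.
  by apply: (mulgI (h 1%g)); rewrite -gmulfM !mulg1.
have hV (h : {multiplicative free_group n -> H}) x : h x^-1%g = (h x)^-1%g.
  by apply: (mulgI (h x)); rewrite -gmulfM !mulgV.
move=> fg u; rewrite -[u]fwordK; elim: (fword u) => [|x s IH].
  exact: etrans (h1 f) (esym (h1 g)).
rewrite -cat1s of_word_cat !gmulfM IH of_word1.
by case: x.2; rewrite ?hV fg.
Qed.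

Lemma free_group_lift n (H : groupType) (t : 'I_n -> H) :
  exists f : {multiplicative free_group n -> H}, forall i, f (gen i) = t i.
Proof.
pose val x := if x.2 then t x.1 else (t x.1)^-1%g.
pose ev (s : seq (letter n)) := (\prod_(x <- s) val x)%g.
have ev_pcons x s : ev (pcons x s) = (val x * ev s)%g.
  case: s => [|y s] /=; rewrite /ev; first by rewrite big_cons.
  case: ifP => [/eqP->|_]; rewrite !big_cons //.
  by case: x => i []; rewrite /val /= mulgA ?mulgV ?mulVg mul1g.
have ev_reduce s : ev (reduce s) = ev s.
  by elim: s => //= x s IH; rewrite ev_pcons IH /ev big_cons.
pose f (u : free_group n) := ev (fword u).
have fM : {morph f : u v / (u * v)%g}.
  by move=> u v; rewrite /f /= ev_reduce /ev big_cat.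
pose fm := isMultiplicative.Build _ _ f fM.
pose F : {multiplicative free_group n -> H} := HB.pack f fm.
by exists F => i; rewrite /F /= /f /= /ev big_seq1.
Qed.

(* The two Wagner tails of the occurrence of a_i^e in v a_i^e v'.             *)
Definition wagner_pair n (i : 'I_n) (e : bool) (v v' : free_group n) :
    seq (free_group n) :=
  if e then [:: v; v'^-1]%g else [:: v * (gen i)^-1; v'^-1 * gen i]%g.

(* j ranges over the positions in the reduced word of u that carry a_i or     *)
(* a_i^-1; the default value of nth is never reached.                         *)
Definition wagner_tails_in n (i : 'I_n) (u : free_group n) :
    seq (free_group n) :=
  let s := fword u in
  let letter_at j := nth (i, true) s j in
  flatten [seq wagner_pair i (letter_at j).2
                 (of_word (take j s)) (of_word (drop j.+1 s))
          | j <- iota 0 (size s) & (letter_at j).1 == i].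

Definition wagner_tails n (phi : free_group n -> free_group n) :
    seq (free_group n) :=
  flatten [seq wagner_tails_in i (phi (gen i)) | i : 'I_n].

(* The leading 1 is the tail of the wedge point, listed only once.            *)
Definition wagner_all_different n (phi : free_group n -> free_group n) : bool :=
  uniq (1%g :: wagner_tails phi).

Definition ball n (p : nat) : set (free_group n) :=
  [set g | (size (fword g) <= p)%N].

(* G_p^n inside G^n = {ffun 'I_n -> G}.                                       *)
Definition cube n (p : nat) : set {ffun 'I_n -> free_group n} :=
  [set t | forall i, ball p (t i)].

(* Hence fset_set in the definition of the density is never applied to an     *)
(* infinite set.                                                              *)
Lemma finite_cube n p : finite_set (@cube n p).
Proof.
pose W := {ffun 'I_n -> {k : 'I_p.+1 & k.-tuple (letter n)}}.
pose F (w : W) := [ffun i => of_word (tagged (w i))].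
apply: (sub_finite_set _ (finite_image F (@finite_finset _ setT))) => t tp.
have tp' i : (size (fword (t i)) < p.+1)%N by rewrite ltnS; apply: tp.
exists [ffun i => Tagged (fun k : 'I_p.+1 => k.-tuple (letter n))
  (in_tuple (fword (t i)) : (Ordinal (tp' i)).-tuple _)] => //.
by apply/ffunP => i; rewrite !ffunE/= fwordK.
Qed.

Definition density_seq (R : realType) n (S : set {ffun 'I_n -> free_group n}) :
    R^nat :=
  fun p => (#|` fset_set (S `&` cube p)|%:R / #|` fset_set (@cube n p)|%:R)%R.

Definition asymptotic_density (R : realType) n
    (S : set {ffun 'I_n -> free_group n}) : R :=
  limn (density_seq R S).

Definition endo_tuple n (phi : free_group n -> free_group n) :
    {ffun 'I_n -> free_group n} :=
  [ffun i => phi (gen i)].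

Definition wagner_set n : set {ffun 'I_n -> free_group n} :=
  [set endo_tuple phi |
     phi in [set phi : {multiplicative free_group n -> free_group n} |
             wagner_all_different phi]].

(* Main.v *)
Require Import Defs.
From HB Require Import structures.
From mathcomp Require Import all_boot all_order all_algebra finmap.
From mathcomp Require Import all_classical all_reals all_analysis.
From mathcomp Require Import zify lra ring.

Set Implicit Arguments.
Unset Strict Implicit.
Unset Printing Implicit Defensive.

Import Order.TTheory GRing.Theory Num.Theory.
Import numFieldNormedType.Exports.

Local Open Scope classical_set_scope.
Local Open Scope ring_scope.

(** Write [l] for one of the 2n letters a_i, a_i^-1, and let W_l be the
reduced word of phi(l), so that the words for l and l^-1 are inverse to each
other. Unwinding the definition of Wagner tails, those of phi are prefixes of
the words W_l: the prefix of length L is a tail for l exactly when the letter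
that follows it is l, or its own last letter is l^-1 ([tail_at]). A given l
has no repeated tail, since its tails have different lengths. Hence all tails
are different as soon as no tail is empty and no two letters l, l' have a
common nonempty tail, that is, a common prefix which is a tail for both
([collide], [wagner_all_different_of_words]). Call the word of phi(a_i) good
if it satisfies this for the two letters a_i, a_i^-1 ([good_word]); what
remains is a condition on each pair i < j ([cross_collide]).

Draw a reduced word uniformly among those of a fixed length, and let
D = 2n - 1. Its prefixes are uniform too, and each further letter takes a given
value with conditional probability at most 1/D. So:
- a word fails to be good with probability at most 1/n + 2/(D(D-1)): the first
  term is for the empty tails, that is, for a first or last letter a_i; the
  second term is for the words v c v^-1 with v a tail ([prob_self_collide]);
- for l, l' coming from different generators, a common tail has probability at
  most 3/(2nD(D-1)): a common prefix of length L costs 1/(2n D^(L-1)), each of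
  the two tail conditions costs 1/D and can be met in two ways, of which one
  combination out of four is contradictory ([mean_collide]).
These bounds hold for every length, hence on every ball, with no error term.

The images of the generators are independent. Let q be one minus the first
bound. A collision for a pair i < j leaves the other n - 2 words free to be
good, so removing the bad pairs from the n-tuples of good words costs only a
fraction c/q^2 of them, where c = 3/(2D) is the sum of the pair bounds
([product_union_bound]). Thus the density on each cube is at least
q^n (1 - c/q^2) ([density_seq_ge]).

Finally, with M = 2(n-1)^2, the k-th numerator of d_n is
(M - 2k + 2)(M - 2k + 1), and for n >= 3 each factor of d_n is at most
(1 - 1/n) q. Hence d_n <= (1 - 1/n)^n q^n <= q^n / 2, while c/q^2 <= 1/2 as soon
as n >= 4. For n = 3 both sides are explicit numbers, and d_2 = 0. *)

(** * Reduced words of a given length *)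

Definition rwords n m : seq (seq (letter n)) :=
  iter m (fun ws => [seq rcons w x | w <- ws,
                     x <- [seq x <- enum {: letter n} | reduced (rcons w x)]])
    [:: [::]].

Lemma reduced_rcons n (s : seq (letter n)) x :
  reduced (rcons s x) = reduced s && ((s == [::]) || (x != linv (last x s))).
Proof. by case: s => [|y s] //=; rewrite /reduced /= rcons_path. Qed.

Lemma reduced_take n (s : seq (letter n)) L : reduced s -> reduced (take L s).
Proof. by rewrite /reduced => rs; apply: take_sorted. Qed.

Lemma mem_rwords n m (s : seq (letter n)) :
  (s \in rwords n m) = (size s == m) && reduced s.
Proof.
elim: m s => [|m IH] s; first by case: s.
apply/allpairsPdep/andP => [[w [x [wm]]]|[]].
  rewrite mem_filter => /andP[rwx _ ->]; split=> //.
  by move: wm; rewrite IH size_rcons eqSS => /andP[].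
case/lastP: s => // w x; rewrite size_rcons eqSS => sw rwx.
exists w, x; split=> //; last by rewrite mem_filter rwx mem_enum.
by rewrite IH sw; move: rwx; rewrite reduced_rcons => /andP[].
Qed.

Lemma rwords_uniq n m : uniq (rwords n m).
Proof.
elim: m => // m IH; apply: allpairs_uniq_dep => //.
  by move=> w _; rewrite filter_uniq // enum_uniq.
by move=> [w x] [w' x'] _ _ /= /rcons_inj [-> ->].
Qed.

Lemma count_rwordsS n m (P : pred (seq (letter n))) :
  count P (rwords n m.+1) =
  (\sum_(w <- rwords n m) #|[pred x | reduced (rcons w x) && P (rcons w x)]|)%N.
Proof.
rewrite -sum1_count big_mkcond /= big_allpairs_dep /=; apply: eq_bigr => w _.
by rewrite big_filter big_enum_cond /= -big_mkcondr sum1_card; apply: eq_card.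
Qed.

Lemma card_letter n : #|{: letter n}| = n.*2.
Proof. by rewrite card_prod card_ord card_bool muln2. Qed.

Lemma card_extensions n m (w : seq (letter n)) : w \in rwords n m ->
  #|[pred x | reduced (rcons w x)]| = (n.*2 - (0 < m))%N.
Proof.
rewrite mem_rwords => /andP[/eqP<- rw]; rewrite -card_letter.
case: w rw => [|y w] rw /=.
  by rewrite subn0; apply: eq_card => x; rewrite !inE.
rewrite subn1 -(cardC1 (linv (last y w))); apply: eq_card => x.
by rewrite !inE rcons_path; move: rw; rewrite /reduced /= => ->.
Qed.

Lemma size_rwordsS n m :
  size (rwords n m.+1) = (size (rwords n m) * (n.*2 - (0 < m)))%N.
Proof.
rewrite -count_predT count_rwordsS -[X in _ = (X * _)%N]sum1_size big_distrl /=.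
rewrite big_seq [RHS]big_seq; apply: eq_bigr => w wm.
by rewrite mul1n -(card_extensions wm); apply: eq_card => x; rewrite !inE andbT.
Qed.

Lemma size_rwords_gt0 n m : (0 < n)%N -> (0 < size (rwords n m))%N.
Proof.
move=> n0; elim: m => // m IH; rewrite size_rwordsS muln_gt0 IH subn_gt0.
by case: m {IH} => [|m] /=; rewrite -muln2; lia.
Qed.

Lemma size_word_inv n (s : seq (letter n)) : size (word_inv s) = size s.
Proof. by rewrite /word_inv size_rev size_map. Qed.

Lemma reduced_word_inv n (s : seq (letter n)) : reduced (word_inv s) = reduced s.
Proof.
suff H (t : seq (letter n)) : reduced t -> reduced (word_inv t).
  by apply/idP/idP => [/H|/H//]; rewrite word_invK.
rewrite /reduced /word_inv rev_sorted sorted_map.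
by apply: sub_sorted => x y /=; rewrite linvK eq_sym.
Qed.

Lemma perm_rwords_inv n m :
  perm_eq (map (@word_inv n) (rwords n m)) (rwords n m).
Proof.
have inj : injective (@word_inv n) by apply: inv_inj; apply: word_invK.
apply/uniq_perm; rewrite ?map_inj_uniq ?rwords_uniq// => w.
rewrite -[w]word_invK mem_map// !mem_rwords !size_word_inv.
by rewrite word_invK reduced_word_inv.
Qed.

(** * Tail lengths and collisions *)

(** When [s] is the word of the image of the letter [l], these are the lengths [L]
of the prefixes of [s] that are Wagner tails coming from [l]. The default values
of [nth] differ from the letters that they are compared with, so that a position
outside [s] never counts. *)
Definition tail_at n (l : letter n) (s : seq (letter n)) (L : nat) : bool :=
  (nth (linv l) s L == l) || ((0 < L)%N && (nth l s L.-1 == linv l)).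

(** The lengths start at 1: any two empty tails coincide, so they are excluded
separately. *)
Definition collide n (l l' : letter n) (s s' : seq (letter n)) : bool :=
  has (fun L => [&& take L s == take L s', tail_at l s L & tail_at l' s' L])
    (iota 1 (size s)).

Lemma linv_neq n (l : letter n) : linv l != l.
Proof. by case: l => i []; rewrite xpair_eqE eqxx. Qed.

Lemma tail_at_le n (l : letter n) s L : tail_at l s L -> (L <= size s)%N.
Proof.
rewrite /tail_at; case: (leqP L (size s)) => // sL.
rewrite nth_default ?(ltnW sL)// (negbTE (linv_neq _)) /=.
by rewrite nth_default 1?eq_sym ?(negbTE (linv_neq _)) ?andbF//; case: L sL.
Qed.

Lemma reduced_nth n (d : letter n) s k : reduced s -> (k.+1 < size s)%N ->
  nth d s k.+1 != linv (nth d s k).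
Proof. by move=> /(sortedP d); apply. Qed.

Lemma nth_word_inv n (d : letter n) s k : (k < size s)%N ->
  nth d (word_inv s) k = linv (nth d s (size s - k.+1)).
Proof.
move=> ks; rewrite /word_inv nth_rev size_map// (nth_map d)//.
by rewrite ltn_subrL; case: (size s) ks.
Qed.

Lemma take_word_inv n (s : seq (letter n)) L :
  take L (word_inv s) = word_inv (drop (size s - L) s).
Proof. by rewrite /word_inv map_drop take_rev size_map. Qed.

(** A reduced word that starts with v and ends with v^-1, for v nonempty, has the
form v c v^-1 with c nonempty: otherwise the middle letter would be its own inverse, or the two
middle letters would cancel. *)
Lemma palindrome_short n (s : seq (letter n)) L : reduced s -> (0 < L)%N ->
  (L <= size s)%N -> take L s = take L (word_inv s) -> (L.*2 < size s)%N.
Proof.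
move=> rs L0 Ls e; rewrite ltnNge; apply/negP => sL.
have [d _] : exists d : letter n, true.
  by case: (s) L0 Ls => [|x ?]; [case: (L)|exists x].
(* The position of the middle letter, or of the left one of the middle two. *)
pose k := (size s).-1./2.
have kL : (k < L)%N by rewrite /k; lia.
have ks : (k < size s)%N by lia.
have := congr1 (fun t => nth d t k) e.
rewrite !nth_take// nth_word_inv//.
have [->|sk] : (size s - k.+1 = k \/ size s - k.+1 = k.+1)%N by rewrite /k; lia.
  by move/eqP; rewrite eq_sym (negbTE (linv_neq _)).
have ks' : (k.+1 < size s)%N by lia.
rewrite sk => e'; have := reduced_nth d rs ks'.
by rewrite e' linvK eqxx.
Qed.

(** * Random reduced words *)

Definition prob_words (R : realFieldType) n m (P : pred (seq (letter n))) : R :=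
  (count P (rwords n m))%:R / (size (rwords n m))%:R.

Section Prob.
Context (R : realFieldType) (n : nat) (n0 : (0 < n)%N).
Notation prob := (@prob_words R n).
Notation nwords m := ((size (rwords n m))%:R : R).
Notation D := (n.*2.-1%:R : R).

Lemma nwords_gt0 m : 0 < nwords m.
Proof. by rewrite ltr0n size_rwords_gt0. Qed.

Lemma prob_le m (P Q : pred (seq (letter n))) :
  (forall w, size w = m -> reduced w -> P w -> Q w) -> prob m P <= prob m Q.
Proof.
move=> PQ; rewrite ler_pM2r ?invr_gt0 ?nwords_gt0// ler_nat.
rewrite -!size_filter; apply: uniq_leq_size.
  by rewrite filter_uniq ?rwords_uniq.
move=> w; rewrite !mem_filter mem_rwords => /andP[Pw /andP[/eqP sw rw]].
by rewrite sw rw eqxx PQ.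
Qed.

Lemma eq_prob m (P Q : pred (seq (letter n))) :
  (forall w, size w = m -> reduced w -> P w = Q w) -> prob m P = prob m Q.
Proof.
by move=> PQ; apply/eqP; rewrite eq_le !prob_le// => w sw rw; rewrite PQ.
Qed.

Lemma prob0 m P : (forall w, size w = m -> reduced w -> ~~ P w) -> prob m P = 0.
Proof.
move=> NP; rewrite (_ : prob m P = prob m pred0).
  by rewrite /prob_words count_pred0 mul0r.
by apply: eq_prob => w sw rw; apply/negbTE/NP.
Qed.

Lemma probT m : prob m predT = 1.
Proof. by rewrite /prob_words count_predT divff// gt_eqF ?nwords_gt0. Qed.

Lemma prob_or m (P Q : pred (seq (letter n))) :
  prob m (fun w => P w || Q w) <= prob m P + prob m Q.
Proof.
rewrite -mulrDl ler_pM2r ?invr_gt0 ?nwords_gt0// -natrD ler_nat.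
by rewrite -(count_predUI P Q) leq_addr.
Qed.

Lemma prob_has m (I : Type) (r : seq I) (P : I -> pred (seq (letter n))) :
  prob m (fun w => has (fun i => P i w) r) <= \sum_(i <- r) prob m (P i).
Proof.
elim: r => [|i r IH]; first by rewrite big_nil /= prob0.
by rewrite big_cons; apply: le_trans (prob_or _ _ _) _; rewrite lerD2l.
Qed.

(** A reduced word of length at least L has a uniform prefix of length L, because
the number of ways to extend a reduced word by one letter depends only on whether
it is empty. *)
Lemma prob_take m L P : (L <= m)%N -> prob m (fun w => P (take L w)) = prob L P.
Proof.
elim: m => [|m IH]; first by rewrite leqn0 => /eqP->; apply: eq_prob => -[].
rewrite leq_eqVlt => /predU1P[->|].
  by apply: eq_prob => w <- _; rewrite take_size.
rewrite ltnS => Lm; rewrite -(IH Lm) /prob_words size_rwordsS count_rwordsS.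
have -> : (\sum_(w <- rwords n m)
    #|[pred x | reduced (rcons w x) && P (take L (rcons w x))]| =
    count (fun w => P (take L w)) (rwords n m) * (n.*2 - (0 < m)))%N.
  rewrite -sum1_count big_distrl /= [RHS]big_mkcond /=.
  rewrite big_seq [RHS]big_seq; apply: eq_bigr => w wm.
  move: (wm); rewrite mem_rwords => /andP[/eqP sw _].
  have E x : take L (rcons w x) = take L w by rewrite -cats1 takel_cat ?sw.
  case: (boolP (P (take L w))) => Pw.
    rewrite mul1n -(card_extensions wm); apply: eq_card => x.
    by rewrite !inE E Pw andbT.
  by apply: eq_card0 => x; rewrite !inE E (negbTE Pw) andbF.
rewrite !natrM -mulf_div divff ?mulr1// pnatr_eq0 -lt0n subn_gt0.
by case: (m) => [|k] /=; lia.
Qed.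

Lemma prob_inv m P : prob m (fun w => P (word_inv w)) = prob m P.
Proof.
rewrite /prob_words; congr (_%:R / _).
by rewrite -[RHS](permP (perm_rwords_inv n m)) count_map.
Qed.

(** Whatever the first letters are, the next letter takes a given value with
conditional probability at most 1/D: it has D possible values, or D + 1 if it is
the first one. *)
Lemma prob_next m L d a P : (L < m)%N ->
  prob m (fun w => P (take L w) && (nth d w L == a)) <= prob L P / D.
Proof.
move=> Lm.
rewrite (_ : prob m _ = prob m (fun w => P (take L (take L.+1 w)) &&
    (nth d (take L.+1 w) L == a))); last first.
  by apply: eq_prob => w _ _; rewrite take_takel // nth_take.
rewrite (prob_take (fun w => P (take L w) && (nth d w L == a)) Lm).
rewrite {1}/prob_words size_rwordsS count_rwordsS.
have le1 : (\sum_(w <- rwords n L) #|[pred x | reduced (rcons w x) &&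
    (P (take L (rcons w x)) && (nth d (rcons w x) L == a))]| <=
    count P (rwords n L))%N.
  rewrite -sum1_count [leqRHS]big_mkcond /= big_seq [leqRHS]big_seq.
  apply: leq_sum => w; rewrite mem_rwords => /andP[/eqP sw _].
  rewrite -sw; case: (boolP (P w)) => Pw; last first.
    rewrite leqn0; apply/eqP/eq_card0 => x; rewrite !inE.
    by rewrite -cats1 take_size_cat// (negbTE Pw) andbF.
  rewrite -(card1 a); apply/subset_leq_card/fintype.subsetP => x.
  by rewrite !inE nth_rcons ltnn eqxx => /and3P[].
rewrite /prob_words natrM invfM -!mulrA ler_pM ?mulr_ge0 ?invr_ge0//.
  by rewrite ler_nat.
rewrite ler_pM2l ?invr_gt0 ?nwords_gt0// lef_pV2 ?posrE ?ltr0n.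
- by rewrite ler_nat; case: (0 < L)%N; lia.
- by case: (0 < L)%N; lia.
- by lia.
Qed.

Lemma prob_nth m L d a : d != a -> prob m (fun w => nth d w L == a) <= D^-1.
Proof.
move=> da; case: (ltnP L m) => Lm.
  apply: le_trans (@prob_next m L d a predT Lm) _.
  by rewrite probT mul1r.
rewrite prob0 ?invr_ge0 ?ler0n// => w sw _.
by rewrite nth_default ?sw.
Qed.

(** * Probability of a collision *)

Lemma nwordsE m : (0 < m)%N -> nwords m = n.*2%:R * D ^+ m.-1.
Proof.
case: m => // m _; elim: m => [|m IH].
  by rewrite size_rwordsS subn0 mul1n expr0 mulr1.
by rewrite size_rwordsS natrM IH /= exprSr mulrA subn1.
Qed.

Lemma prob_nth0 m d a : d != a -> prob m (fun w => nth d w 0 == a) <= n.*2%:R^-1.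
Proof.
move=> da; case: m => [|m].
  by rewrite prob0 ?invr_ge0 ?ler0n// => w /size0nil->.
rewrite (_ : prob _ _ = prob m.+1 (fun w => nth d (take 1 w) 0 == a)); last first.
  by apply: eq_prob => w _ _; rewrite nth_take.
rewrite (prob_take (fun w => nth d w 0 == a))//.
rewrite /prob_words -[in X in _ <= X]div1r size_rwordsS mul1n subn0.
rewrite ler_pM2r ?invr_gt0 ?ltr0n ?double_gt0// lern1 count_rwordsS big_seq1.
rewrite -(card1 a); apply/subset_leq_card/fintype.subsetP => x.
by rewrite !inE.
Qed.

Lemma prob_tail_at0 m l : prob m (fun w => tail_at l w 0) <= n.*2%:R^-1.
Proof.
apply: le_trans (prob_nth0 m (linv_neq l)); apply: prob_le => w _ _.
by rewrite /tail_at orbF.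
Qed.

Lemma prob_tail_at m l L : prob m (fun w => tail_at l w L) <= 2 / D.
Proof.
rewrite -[2]/(1 + 1) mulrDl mul1r; apply: le_trans (prob_or _ _ _) _.
apply: lerD; first by apply: prob_nth; apply: linv_neq.
apply: le_trans (_ : prob m (fun w => nth l w L.-1 == linv l) <= _).
  by apply: prob_le => w _ _ /andP[].
by apply: prob_nth; rewrite eq_sym linv_neq.
Qed.

Lemma prob_pred1 L v : size v = L -> reduced v -> prob L (pred1 v) = (nwords L)^-1.
Proof.
move=> sv rv; rewrite /prob_words count_uniq_mem ?rwords_uniq// mem_rwords sv eqxx rv.
by rewrite div1r.
Qed.

Lemma D_gt1 : (1 < n)%N -> 1 < D.
Proof. by move=> n1; rewrite ltr1n; lia. Qed.

Lemma geometric_le m : (1 < n)%N ->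
  \sum_(L <- iota 1 m) D^-1 ^+ L <= (D - 1)^-1.
Proof.
move=> /D_gt1 D1; have D10 : 0 < D - 1 by rewrite subr_gt0.
have Dn0 : D != 0 by rewrite gt_eqF// (lt_trans _ D1).
suff -> : \sum_(L <- iota 1 m) D^-1 ^+ L = (1 - D^-1 ^+ m) / (D - 1).
  by rewrite ler_pdivrMr// mulVf ?gt_eqF// gerBl exprn_ge0// invr_ge0 ler0n.
elim: m => [|m IH]; first by rewrite big_nil expr0 subrr mul0r.
rewrite -(addn1 m) iotaD big_cat IH /= big_seq1 add1n addn1 !exprS.
by field; rewrite Dn0 gt_eqF.
Qed.

(** The word v c v^-1 is determined by its prefix v c, which is a reduced word
with L letters less, whence the factor D^-L; being a tail for l is a condition
on v c only, as c is nonempty. *)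
Lemma prob_palindrome m l L : (0 < L)%N ->
  prob m (fun w => (take L w == take L (word_inv w)) && tail_at l w L) <=
  2 / D * D^-1 ^+ L.
Proof.
move=> L0.
case: (ltnP L.*2 m) => Lm; last first.
  rewrite prob0 ?mulr_ge0 ?exprn_ge0 ?invr_ge0 ?ler0n// => w sw rw.
  apply/negP => /andP[/eqP e /tail_at_le Lw].
  by have := palindrome_short rw L0 Lw e; rewrite sw ltnNge Lm.
apply: le_trans (ler_wpM2r _ (prob_tail_at (m - L) l L)); last first.
  by rewrite exprn_ge0 ?invr_ge0 ?ler0n.
have -> : prob m (fun w => (take L w == take L (word_inv w)) && tail_at l w L) =
  (count (fun w => (take L w == take L (word_inv w)) && tail_at l w L)
     (rwords n m))%:R / (nwords (m - L)) * D^-1 ^+ L.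
  rewrite /prob_words -mulrA; congr (_ * _); rewrite !nwordsE; try lia.
  rewrite (_ : m.-1 = (m - L).-1 + L)%N; last by lia.
  by rewrite exprD mulrA invfM exprVn.
rewrite ler_wpM2r ?exprn_ge0 ?invr_ge0 ?ler0n//.
rewrite ler_wpM2r ?invr_ge0 ?ler0n// ler_nat.
rewrite -!size_filter; set s1 := [seq _ <- _ | _].
have P1 w : w \in s1 -> [/\ size w = m, reduced w,
    w = take (m - L) w ++ word_inv (take L (take (m - L) w)) &
    tail_at l (take (m - L) w) L].
  rewrite mem_filter mem_rwords => /andP[/andP[/eqP e t] /andP[/eqP sw rw]].
  split=> //.
    rewrite take_takel; last by lia.
    by rewrite e take_word_inv word_invK sw cat_take_drop.
  move: t; rewrite /tail_at !nth_take//; lia.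
rewrite -(size_map (take (m - L)) s1); apply: uniq_leq_size.
  rewrite map_inj_in_uniq ?filter_uniq ?rwords_uniq//.
  by move=> w w' /P1[_ _ e1 _] /P1[_ _ e2 _] /= e; rewrite e1 e -e2.
move=> v /mapP[w /P1[sw rw _ t] ->]; rewrite mem_filter t mem_rwords.
by rewrite size_takel ?sw ?eqxx ?reduced_take//; lia.
Qed.

Lemma prob_self_collide m l l' : (1 < n)%N ->
  prob m (fun w => collide l l' w (word_inv w)) <= 2 / (D * (D - 1)).
Proof.
move=> n1; pose P L (w : seq (letter n)) :=
  (take L w == take L (word_inv w)) && tail_at l w L.
apply: le_trans (_ : prob m (fun w => has (fun L => P L w) (iota 1 m)) <= _).
  apply: prob_le => w sw _; rewrite /collide sw.
  by apply: sub_has => L /and3P[e t _]; rewrite /P e.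
apply: le_trans (prob_has _ _ _) _.
apply: le_trans (_ : \sum_(L <- iota 1 m) 2 / D * D^-1 ^+ L <= _).
  rewrite big_seq [leRHS]big_seq; apply: ler_sum => L; rewrite mem_iota => /andP[L0 _].
  exact: prob_palindrome.
by rewrite -mulr_sumr invfM mulrA ler_wpM2l ?geometric_le// divr_ge0 ?ler0n.
Qed.

Definition mean m (f : seq (letter n) -> R) : R :=
  (\sum_(w <- rwords n m) f w) / nwords m.

Lemma mean_le m f g : (forall w, size w = m -> reduced w -> f w <= g w) ->
  mean m f <= mean m g.
Proof.
move=> fg; rewrite ler_pM2r ?invr_gt0 ?nwords_gt0//.
rewrite big_seq [leRHS]big_seq; apply: ler_sum => w.
by rewrite mem_rwords => /andP[/eqP sw rw]; apply: fg.
Qed.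

Lemma mean_sum m (r : seq nat) f :
  mean m (fun w => \sum_(L <- r) f L w) = \sum_(L <- r) mean m (f L).
Proof. by rewrite /mean exchange_big /= mulr_suml. Qed.

Lemma meanD m f g : mean m (fun w => f w + g w) = mean m f + mean m g.
Proof. by rewrite /mean big_split mulrDl. Qed.

Lemma meanZ m f c : mean m (fun w => f w * c) = mean m f * c.
Proof. by rewrite /mean -mulr_suml mulrAC. Qed.

Lemma mean_prob m (P : pred (seq (letter n))) : mean m (fun w => (P w)%:R) = prob m P.
Proof.
rewrite /mean /prob_words -sum1_count natr_sum [in RHS]big_mkcond.
by congr (_ / _); apply: eq_bigr => w _; case: (P w).
Qed.

(** If the last letter of the common prefix is the inverse of [l'], the tail
condition on the random word holds already; otherwise it fixes one more letter,
at the cost of a factor 1/D. *)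
Lemma prob_collide_at m' l' L w : (0 < L <= size w)%N -> reduced w ->
  prob m' (fun w' => (take L w == take L w') && tail_at l' w' L) <=
  ((nth l' w L.-1 == linv l')%:R + D^-1) / nwords L.
Proof.
move=> /andP[L0 Lw] rw.
case: (leqP L m') => Lm; last first.
  rewrite prob0 ?mulr_ge0 ?addr_ge0 ?invr_ge0 ?ler0n// => w' sw' _.
  by apply/negP => /andP[_ /tail_at_le]; rewrite sw' leqNgt Lm.
have pv : prob L (pred1 (take L w)) = (nwords L)^-1.
  by apply: prob_pred1; rewrite ?size_takel ?reduced_take.
apply: le_trans (_ : prob m' (fun w' =>
   ((take L w' == take L w) && (nth l' w L.-1 == linv l')) ||
   ((take L w' == take L w) && (nth (linv l') w' L == l'))) <= _).
  apply: prob_le => w' _ _ /andP[/eqP e]; rewrite e eqxx /= orbC.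
  have nthE : nth l' w L.-1 = nth l' w' L.-1.
    by have := congr1 (fun t => nth l' t L.-1) e; rewrite !nth_take//; lia.
  by rewrite nthE /tail_at L0.
apply: le_trans (prob_or _ _ _) _; rewrite mulrDl; apply: lerD.
  case: (nth l' w L.-1 == linv l').
    rewrite mul1r -pv -(prob_take (pred1 (take L w)) Lm).
    by apply: prob_le => w' _ _ /andP[].
  by rewrite mul0r prob0// => w' _ _; rewrite andbF.
move: Lm; rewrite leq_eqVlt => /predU1P[Lm|Lm].
  rewrite prob0 ?mulr_ge0 ?invr_ge0 ?ler0n// => w' sw' _.
  by rewrite nth_default ?sw' ?Lm// (negbTE (linv_neq _)) andbF.
rewrite mulrC -pv.
exact: (@prob_next m' L (linv l') l' (pred1 (take L w)) Lm).
Qed.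

Lemma prob_turn m l l' L : (0 < L)%N ->
  prob m (fun w => (nth l' w L.-1 == linv l') && (nth (linv l) w L == l)) <=
  D^-1 * D^-1.
Proof.
move=> L0; case: (ltnP L m) => Lm; last first.
  rewrite prob0 ?mulr_ge0 ?invr_ge0 ?ler0n// => w sw _.
  by rewrite [nth (linv l) _ _]nth_default ?sw// (negbTE (linv_neq _)) andbF.
rewrite (_ : prob m _ = prob m (fun w => (nth l' (take L w) L.-1 == linv l') &&
   (nth (linv l) w L == l))); last first.
  by apply: eq_prob => w _ _; rewrite nth_take//; lia.
apply: le_trans (prob_next _ _ (fun v => nth l' v L.-1 == linv l') Lm) _.
rewrite ler_wpM2r ?invr_ge0 ?ler0n// prob_nth//.
by rewrite eq_sym linv_neq.
Qed.

(** Averaging [prob_collide_at] over [w]. The prefix cannot end both in l^-1 and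
in l'^-1, so if it ends in l'^-1 then it is a tail for l only because it is
followed by l, and that has probability at most 1/D^2 ([prob_turn]). *)
Lemma mean_collide m m' l l' : (1 < n)%N -> l != l' ->
  mean m (fun w => prob m' (collide l l' w)) <= 3 / (n.*2%:R * D * (D - 1)).
Proof.
move=> n1 ll'.
pose F L w := (tail_at l w L)%:R * ((nth l' w L.-1 == linv l')%:R + D^-1) / nwords L.
apply: le_trans (_ : mean m (fun w => \sum_(L <- iota 1 m) F L w) <= _).
  apply: mean_le => w sw rw; rewrite /collide.
  apply: le_trans (prob_has _ _ _) _; rewrite sw.
  rewrite big_seq [leRHS]big_seq; apply: ler_sum => L.
  rewrite mem_iota add1n ltnS => L0m; rewrite /F.
  case: (tail_at l w L); last by rewrite !mul0r prob0// => w' _ _; rewrite andbF.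
  by rewrite mul1r; apply: prob_collide_at; rewrite ?sw.
rewrite mean_sum.
apply: le_trans (_ : \sum_(L <- iota 1 m) 3 / (n.*2%:R * D) * D^-1 ^+ L <= _); last first.
  by rewrite -mulr_sumr [in leRHS]invfM [leRHS]mulrA ler_wpM2l ?geometric_le//.
rewrite big_seq [leRHS]big_seq; apply: ler_sum => L; rewrite mem_iota => /andP[L0 _].
rewrite meanZ.
have -> : 3 / (n.*2%:R * D) * D^-1 ^+ L = (D^-1 * D^-1 + 2 / D * D^-1) / nwords L.
  rewrite (nwordsE L0) -{1}(prednK L0) exprS invfM [in RHS]invfM exprVn.
  set a := (n.*2%:R)^-1; set b := (D ^+ _)^-1; set c := D^-1; ring.
rewrite ler_wpM2r ?invr_ge0 ?ler0n//.
apply: le_trans (_ : mean m (fun w =>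
   ((nth l' w L.-1 == linv l') && (nth (linv l) w L == l))%:R +
   (tail_at l w L)%:R * D^-1) <= _).
  apply: mean_le => w _ _; rewrite mulrDr lerD2r -natrM mulnb ler_nat.
  have : (tail_at l w L && (nth l' w L.-1 == linv l')) ==>
     ((nth l' w L.-1 == linv l') && (nth (linv l) w L == l)).
    apply/implyP => /andP[t e]; rewrite e /=; case/orP: t => // /andP[_ /eqP e'].
    have Lw : (L.-1 < size w)%N.
      rewrite ltnNge; apply/negP => wL; move/eqP: e; rewrite nth_default//.
      by move/eqP; rewrite eq_sym (negbTE (linv_neq _)).
    move: e; rewrite (set_nth_default l)// e' => /eqP /(inv_inj (@linvK n)) ll.
    by rewrite ll eqxx in ll'.
  by do 2 case: (_ && _).
rewrite meanD meanZ !mean_prob; apply: lerD; first exact: prob_turn.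
by rewrite ler_wpM2r ?invr_ge0 ?ler0n// prob_tail_at.
Qed.

End Prob.

(** * Wagner tails as prefixes *)

Lemma uniq_flatten_map (S T : eqType) (f : S -> seq T) (s : seq S) : uniq s ->
  {in s, forall x, uniq (f x)} ->
  {in s &, forall x y, x != y -> forall z, z \in f x -> z \notin f y} ->
  uniq (flatten (map f s)).
Proof.
elim: s => //= x s IH /andP[xs us] uf dis; rewrite cat_uniq uf ?mem_head//=.
rewrite IH ?andbT//.
- apply/hasPn => z /flatten_mapP[y ys zy]; apply: (dis y x) => //.
  + by rewrite inE ys orbT.
  + by rewrite mem_head.
  + by apply: contraNneq xs => <-.
- by move=> y ys; apply: uf; rewrite inE ys orbT.
- by move=> y z ys zs; apply: dis; rewrite inE ?ys ?zs orbT.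
Qed.

Lemma inv_of_word n (s : seq (letter n)) : reduced s ->
  ((of_word s)^-1)%g = of_word (word_inv s).
Proof. by move=> rs; rewrite -{2}(of_wordK rs). Qed.

Lemma inv_gen n (i : 'I_n) : ((gen i)^-1)%g = of_word [:: (i, false)].
Proof. by rewrite [RHS]of_word1. Qed.

Lemma of_word_take_inj n (s s' : seq (letter n)) L L' :
  reduced s -> reduced s' -> of_word (take L s) = of_word (take L' s') ->
  take L s = take L' s'.
Proof.
by move=> rs rs' /(congr1 (@fword n)); rewrite !of_wordK// reduced_take.
Qed.

(** The tails of an occurrence of a_i are the parts of the word before it and,
read backwards and inverted, after it; for an occurrence of a_i^-1 both parts
include the occurrence itself. *)
Lemma wagner_pairE n (i : 'I_n) e (s : seq (letter n)) j d :
  reduced s -> (j < size s)%N -> nth d s j = (i, e) ->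
  wagner_pair i e (of_word (take j s)) (of_word (drop j.+1 s)) =
  [:: of_word (take (j + ~~ e) s);
      of_word (take (size s - j.+1 + ~~ e) (word_inv s))].
Proof.
move=> rs js sj; have rd : reduced (drop j.+1 s) by apply: drop_sorted.
case: e sj => /= sj.
  rewrite !addn0 inv_of_word// take_word_inv.
  by congr [:: _; of_word (word_inv (drop _ _))]; lia.
rewrite inv_of_word// inv_gen /gen -!of_word_cat; congr [:: of_word _; of_word _].
  by rewrite addn1 (take_nth d)// sj cats1.
rewrite take_word_inv (_ : size s - _ = j)%N; last by lia.
by rewrite (drop_nth d js) sj /word_inv map_cons rev_cons cats1.
Qed.

Lemma wagner_pair_tail_at n (i : 'I_n) e (s : seq (letter n)) j d :
  (j < size s)%N -> nth d s j = (i, e) ->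
  tail_at (i, true) s (j + ~~ e) /\
  tail_at (i, false) (word_inv s) (size s - j.+1 + ~~ e).
Proof.
move=> js sj.
have inv_j d' : nth d' (word_inv s) (size s - j.+1) = (i, ~~ e).
  rewrite nth_word_inv; last by lia.
  rewrite (_ : size s - _ = j)%N; last by lia.
  by rewrite (set_nth_default d)// sj.
have s_j d' : nth d' s j = (i, e) by rewrite (set_nth_default d).
rewrite /tail_at; case: e sj inv_j s_j => sj inv_j s_j /=.
  by rewrite !addn0 inv_j s_j !eqxx.
by rewrite !addn1 /= inv_j s_j /linv /= !eqxx !orbT.
Qed.

(** The word of the image of a_i ([b = true]) or of a_i^-1 ([b = false]), where [s]
is that of the image of a_i. *)
Definition end_word n (b : bool) (s : seq (letter n)) : seq (letter n) :=
  if b then s else word_inv s.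

Definition good_word n (i : 'I_n) (s : seq (letter n)) : bool :=
  [&& ~~ tail_at (i, true) s 0, ~~ tail_at (i, false) (word_inv s) 0 &
      ~~ collide (i, true) (i, false) s (word_inv s)].

Definition cross_collide n (i j : 'I_n) (s s' : seq (letter n)) : bool :=
  [exists b, exists b', collide (i, b) (j, b') (end_word b s) (end_word b' s')].

Lemma end_word_reduced n b (s : seq (letter n)) :
  reduced s -> reduced (end_word b s).
Proof. by case: b => //=; rewrite reduced_word_inv. Qed.

Lemma collide_prefix n (l l' : letter n) s s' L L' : (0 < L)%N ->
  tail_at l s L -> tail_at l' s' L' -> take L s = take L' s' ->
  collide l l' s s'.
Proof.
move=> L0 t t' e; have LL : L = L'.
  have := congr1 size e.
  by rewrite !size_takel ?(tail_at_le t)// (tail_at_le t').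
subst L'; apply/hasP; exists L; last by rewrite e eqxx t t'.
by rewrite mem_iota L0 add1n ltnS (tail_at_le t).
Qed.

Section WagnerTails.
Context (n : nat).
Implicit Types (i : 'I_n) (u g : free_group n).

Lemma wagner_tails_inP i u g : g \in wagner_tails_in i u ->
  exists b L, tail_at (i, b) (end_word b (fword u)) L /\
    g = of_word (take L (end_word b (fword u))).
Proof.
move=> /flatten_mapP[j]; rewrite mem_filter mem_iota /= => /andP[/eqP ji js].
have [e sj] : exists e, nth (i, true) (fword u) j = (i, e).
  by exists (nth (i, true) (fword u) j).2; rewrite -{2}ji -surjective_pairing.
rewrite sj /= (wagner_pairE (fword_reduced u) js sj).
have [t t'] := wagner_pair_tail_at js sj.
rewrite !inE => /orP[] /eqP->; [exists true|exists false]; eexists; split=> //.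
- exact: t.
- exact: t'.
Qed.

Lemma good_word_tail_gt0 i b s L : good_word i s ->
  tail_at (i, b) (end_word b s) L -> (0 < L)%N.
Proof.
by case: L => // /and3P[g g' _]; case: b => /= t; [rewrite t in g|rewrite t in g'].
Qed.

(** A tail of a_i and a tail of a_i^-1 differ because the word is good. Two tails of
the same letter have different lengths: the length determines the position of the
occurrence up to one, and two adjacent occurrences that give the same length would
be inverse letters. *)
Lemma uniq_wagner_tails_in i u : good_word i (fword u) ->
  uniq (wagner_tails_in i u).
Proof.
set s := fword u => gs; have rs : reduced s := fword_reduced u.
have rs' : reduced (word_inv s) by rewrite reduced_word_inv.
have [_ _ nc] := and3P gs.
have key j : j \in [seq j <- iota 0 (size s) | (nth (i, true) s j).1 == i] ->
    exists e, [/\ (j < size s)%N, nth (i, true) s j = (i, e) &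
     wagner_pair i (nth (i, true) s j).2 (of_word (take j s))
       (of_word (drop j.+1 s)) =
     [:: of_word (take (j + ~~ e) s);
      of_word (take (size s - j.+1 + ~~ e) (word_inv s))]].
  rewrite mem_filter mem_iota /= => /andP[/eqP ji js].
  exists (nth (i, true) s j).2; split=> //.
    by rewrite -{2}ji -surjective_pairing.
  by apply: wagner_pairE => //; rewrite -{2}ji -surjective_pairing.
have cross L L' : tail_at (i, true) s L -> tail_at (i, false) (word_inv s) L' ->
    of_word (take L s) != of_word (take L' (word_inv s)).
  move=> t t'; apply: contraNneq nc => /(of_word_take_inj rs rs').
  by apply: (collide_prefix _ t t'); apply: (@good_word_tail_gt0 i true s).
apply: uniq_flatten_map; first by rewrite filter_uniq ?iota_uniq.
  move=> j /key[e [js sj ->]]; have [t t'] := wagner_pair_tail_at js sj.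
  by rewrite /= !inE cross.
move=> j k /key[e [js sj ->]] /key[e' [ks sk ->]] jk g.
have [t1 t1'] := wagner_pair_tail_at js sj.
have [t2 t2'] := wagner_pair_tail_at ks sk.
have adj p b : (p.+1 < size s)%N -> nth (i, true) s p = (i, b) ->
    nth (i, true) s p.+1 <> (i, ~~ b).
  move=> ps sp sp'; have := reduced_nth (i, true) rs ps.
  by rewrite sp sp' eqxx.
have jk' : (j + ~~ e != k + ~~ e')%N.
  apply: contra_neq jk; case: e e' sj sk {t1 t1' t2 t2'} => [] [] sj sk /= E.
  - by lia.
  - by have jE : j = k.+1 by [lia]; subst j; case: (adj _ _ js sk).
  - by have kE : k = j.+1 by [lia]; subst k; case: (adj _ _ ks sj).
  - by lia.
have jk'' : (size s - j.+1 + ~~ e != size s - k.+1 + ~~ e')%N.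
  apply: contra_neq jk; case: e e' sj sk {t1 t1' t2 t2' jk'} => [] [] sj sk /= E.
  - by lia.
  - by have kE : k = j.+1 by [lia]; subst k; case: (adj _ _ ks sj).
  - by have jE : j = k.+1 by [lia]; subst j; case: (adj _ _ js sk).
  - by lia.
rewrite !inE => /orP[] /eqP->; rewrite negb_or.
- rewrite cross// andbT; apply: contraNneq jk' => /(of_word_take_inj rs rs).
  move=> /(congr1 size); rewrite !size_takel ?(tail_at_le t1) ?(tail_at_le t2)//.
  by move->.
- rewrite eq_sym cross//=; apply: contraNneq jk'' => /(of_word_take_inj rs' rs').
  move=> /(congr1 size); rewrite !size_takel ?(tail_at_le t1') ?(tail_at_le t2')//.
  by move->.
Qed.

Lemma wagner_all_different_of_words (phi : free_group n -> free_group n) :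
  (forall i, good_word i (fword (phi (gen i)))) ->
  (forall i j : 'I_n, (i < j)%N ->
     ~~ cross_collide i j (fword (phi (gen i))) (fword (phi (gen j)))) ->
  wagner_all_different phi.
Proof.
move=> good cross; rewrite /wagner_all_different cons_uniq; apply/andP; split.
  apply/negP => /flatten_mapP[i _ /wagner_tails_inP[b [L [t]]]].
  have rt : reduced (take L (end_word b (fword (phi (gen i))))).
    exact/reduced_take/end_word_reduced/fword_reduced.
  move=> /(congr1 (@fword n)); rewrite !of_wordK//.
  move=> /esym/(congr1 size); rewrite size_takel ?(tail_at_le t)//= => L0.
  by have := good_word_tail_gt0 (good i) t; rewrite L0.
apply: uniq_flatten_map; first exact: enum_uniq.
  by move=> i _; apply: uniq_wagner_tails_in.
have main (i j : 'I_n) g : (i < j)%N -> g \in wagner_tails_in i (phi (gen i)) ->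
    g \in wagner_tails_in j (phi (gen j)) -> False.
  move=> ij /wagner_tails_inP[b [L [t ->]]] /wagner_tails_inP[b' [L' [t']]].
  move=> /of_word_take_inj e; have := cross i j ij; apply/negP; rewrite negbK.
  apply/existsP; exists b; apply/existsP; exists b'.
  apply: (collide_prefix (good_word_tail_gt0 (good i) t) t t').
  by apply: e; rewrite end_word_reduced ?fword_reduced.
move=> i j _ _ ij g gi; apply/negP => gj.
case: (ltngtP i j) => [lij|lji|/val_inj eij].
- exact: main lij gi gj.
- exact: main lji gj gi.
- by rewrite eij eqxx in ij.
Qed.

End WagnerTails.

(** * A union bound in a finite product *)

Lemma card_family_prod n (T : finType) (F : 'I_n -> pred T) :
  #|[pred f : {ffun 'I_n -> T} | [forall i, F i (f i)]]| = (\prod_i #|F i|)%N.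
Proof.
rewrite -[RHS]/(\big[muln/1%N]_(i | true) #|F i|).
transitivity #|(family F : simpl_pred {dffun forall x : 'I_n, T})|.
  by apply: eq_card => f; rewrite !inE.
by rewrite card_family foldrE big_image.
Qed.

Lemma card_pair_constraint n (T : finType) (i j : 'I_n) (E : 'I_n -> pred T)
    (B : rel T) : i != j ->
  #|[pred f : {ffun 'I_n -> T} | B (f i) (f j) &&
     [forall k, (k != i) && (k != j) ==> E k (f k)]]| =
  (#|[pred xy : T * T | B xy.1 xy.2]| *
   \prod_(k | (k != i) && (k != j)) #|E k|)%N.
Proof.
move=> ij; pose F (xy : T * T) k : pred T :=
  
    if k == i then xpred1 xy.1 else if k == j then xpred1 xy.2 else E k.
rewrite -sum1_card (partition_big (fun f : {ffun 'I_n -> T} => (f i, f j))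
  (fun xy => B xy.1 xy.2)) /=; last by move=> f /andP[].
rewrite -sum1_card big_distrl /=; apply: eq_bigr => xy Bxy.
rewrite mul1n sum1_card; transitivity (\prod_k #|F xy k|)%N.
  rewrite -card_family_prod; apply: eq_card => f; rewrite !inE; apply/idP/forallP.
    move=> /andP[/andP[_ /forallP fE] /eqP e] k; rewrite /F -e.
    case: eqP => [->|/eqP ki]; first exact: eqxx.
    case: eqP => [->|/eqP kj]; first exact: eqxx.
    by have := fE k; rewrite ki kj.
  move=> fF; have := fF i; rewrite /F eqxx => /eqP fi.
  have := fF j; rewrite /F eq_sym (negbTE ij) eqxx => /eqP fj.
  rewrite unfold_in !inE /= fi fj Bxy -surjective_pairing eqxx andbT; apply/forallP => k.
  by apply/implyP => /andP[/negbTE ki /negbTE kj]; have := fF k; rewrite /F ki kj.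
rewrite (bigD1 i)//= (bigD1 j) 1?eq_sym//= {1 2}/F eqxx eq_sym (negbTE ij) eqxx.
rewrite !card1 !mul1n; apply: eq_bigr => k /andP[/negbTE ki /negbTE kj].
by rewrite /F ki kj.
Qed.

Lemma sum_lt_pairs n : (\sum_(j < n) \sum_(i < n | (i < j)%N) 1 = 'C(n, 2))%N.
Proof.
rewrite -bin2_sum big_mkord; apply: eq_bigr => j _.
by rewrite -(big_ord_widen n (fun=> 1%N)) ?sum1_card ?card_ord// ltnW.
Qed.

(** For independent uniform coordinates, each of which satisfies its own condition
[E i] with probability at least q, while each pair is in conflict with probability
at most b. Restricting a conflict of i and j to the tuples that satisfy the
conditions at the other coordinates gives it weight at most b/q^2 relative to the
tuples that satisfy all conditions. Merely subtracting b for each pair would give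
q^n - C(n, 2) b, which may be negative (as it is for rank 3). *)
Lemma product_union_bound (R : realFieldType) n (T : finType)
    (E : 'I_n -> pred T) (B : 'I_n -> 'I_n -> rel T) (q b : R) :
  0 < q -> 0 <= b -> (0 < #|T|)%N ->
  (forall i, q * #|T|%:R <= #|E i|%:R) ->
  (forall i j : 'I_n, (i < j)%N ->
     #|[pred xy : T * T | B i j xy.1 xy.2]|%:R <= b * #|T|%:R ^+ 2) ->
  'C(n, 2)%:R * b <= q ^+ 2 ->
  q ^+ n * (1 - 'C(n, 2)%:R * b / q ^+ 2) * #|T|%:R ^+ n <=
  #|[pred f : {ffun 'I_n -> T} | [forall i, E i (f i)] &&
     [forall i : 'I_n, forall j : 'I_n, (i < j)%N ==> ~~ B i j (f i) (f j)]]|%:R.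
Proof.
move=> q0 b0 T0 hE hB hb.
set good := [pred f : {ffun 'I_n -> T} | _].
pose bad (i j : 'I_n) := [pred f : {ffun 'I_n -> T} | B i j (f i) (f j) &&
     [forall k, (k != i) && (k != j) ==> E k (f k)]].
pose t : R := #|T|%:R; have t0 : 0 < t by rewrite ltr0n.
pose e i : R := #|E i|%:R.
have e0 i : 0 < e i by apply: lt_le_trans (hE i); rewrite mulr_gt0.
have cover : (#|[pred f : {ffun 'I_n -> T} | [forall i, E i (f i)]]| <=
    #|good| + \sum_(j < n) \sum_(i < n | (i < j)%N) #|bad i j|)%N.
  rewrite -!sum1_card big_mkcond [X in (_ <= X + _)%N]big_mkcond /=.
  have -> : (\sum_(j < n) \sum_(i < n | (i < j)%N) #|bad i j| =
      \sum_(f : {ffun 'I_n -> T})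
        \sum_(j < n) \sum_(i < n | (i < j)%N) (f \in bad i j))%N.
    rewrite exchange_big; apply: eq_bigr => j _.
    rewrite exchange_big; apply: eq_bigr => i _.
    by rewrite -sum1_card big_mkcond; apply: eq_bigr => f _; case: ifP.
  rewrite -big_split; apply: leq_sum => f _; rewrite !inE.
  case: (boolP [forall i, E i (f i)]) => //= /forallP fE.
  case: (boolP [forall i, _]) => //= /forallPn [i /forallPn [j]].
  rewrite negb_imply negbK => /andP[ij fB].
  rewrite (bigD1 j)//= (bigD1 i)//= !inE fB /=.
  by rewrite (_ : [forall k, _]); last by apply/forallP => k; rewrite fE implybT.
have bad_le (i j : 'I_n) : (i < j)%N ->
    #|bad i j|%:R <= b / q ^+ 2 * \prod_k e k.
  move=> ij; have nij : i != j by rewrite neq_ltn ij.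
  rewrite card_pair_constraint// natrM natr_prod.
  rewrite [in leRHS](bigD1 i)//= [in leRHS](bigD1 j) 1?eq_sym//=.
  rewrite !mulrA ler_wpM2r//; first by apply: prodr_ge0.
  apply: le_trans (hB i j ij) _; rewrite -!mulrA ler_wpM2l//.
  rewrite mulrC ler_pdivlMr ?exprn_gt0// -exprMn [_ * q]mulrC expr2.
  by apply: ler_pM; rewrite ?(mulr_ge0 (ltW q0))//; apply: hE.
have sum_bad : (\sum_(j < n) \sum_(i < n | (i < j)%N) #|bad i j|)%:R <=
    'C(n, 2)%:R * (b / q ^+ 2 * \prod_k e k).
  rewrite -sum_lt_pairs !natr_sum mulr_suml; apply: ler_sum => j _.
  rewrite !natr_sum mulr_suml; apply: ler_sum => i ij.
  by rewrite mul1r bad_le.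
have prod_ge : q ^+ n * t ^+ n <= \prod_k e k.
  rewrite -exprMn -[X in _ ^+ X]card_ord -prodr_const.
  by apply: ler_prod => k _; rewrite (mulr_ge0 (ltW q0) (ltW t0)); apply: hE.
have prodE : #|[pred f : {ffun 'I_n -> T} | [forall i, E i (f i)]]|%:R = \prod_k e k.
  by rewrite card_family_prod natr_prod.
move: cover; rewrite -(ler_nat R) natrD prodE -lerBlDr; apply: le_trans.
apply: le_trans (_ : (1 - 'C(n, 2)%:R * b / q ^+ 2) * \prod_k e k <= _).
  rewrite mulrAC mulrC ler_wpM2l// subr_ge0 ler_pdivrMr ?exprn_gt0//.
  by rewrite mul1r.
rewrite mulrBl mul1r lerD2l lerN2; apply: le_trans sum_bad _.
by rewrite !mulrA.
Qed.

(** * Balls of the free group *)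

Definition ball_words n p : seq (seq (letter n)) :=
  flatten [seq rwords n m | m <- iota 0 p.+1].

Lemma mem_ball_words n p (s : seq (letter n)) :
  (s \in ball_words n p) = (size s <= p)%N && reduced s.
Proof.
apply/flatten_mapP/andP => [[m]|[sp rs]].
  by rewrite mem_iota mem_rwords add0n ltnS => mp /andP[/eqP-> ->].
by exists (size s); rewrite ?mem_iota ?mem_rwords ?eqxx.
Qed.

Lemma ball_words_uniq n p : uniq (ball_words n p).
Proof.
apply: uniq_flatten_map; first exact: iota_uniq.
  by move=> m _; apply: rwords_uniq.
move=> m m' _ _ mm' w; rewrite !mem_rwords => /andP[/eqP-> _].
by rewrite (negbTE mm').
Qed.

Section BallCounts.
Context (R : realFieldType) (n : nat) (n1 : (1 < n)%N).
Let n0 : (0 < n)%N := ltnW n1.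
Notation prob := (@prob_words R n).
Notation D := (n.*2.-1%:R : R).

Lemma mean_inv m (f : seq (letter n) -> R) :
  mean m (fun w => f (word_inv w)) = mean m f.
Proof.
by rewrite /mean -[in RHS](perm_big _ (perm_rwords_inv n m)) big_map.
Qed.

Lemma prob_bad_word i m :
  prob m (fun w => ~~ good_word i w) <= n%:R^-1 + 2 / (D * (D - 1)).
Proof.
apply: le_trans (_ : prob m (fun w => tail_at (i, true) w 0 ||
  (tail_at (i, false) (word_inv w) 0 ||
   collide (i, true) (i, false) w (word_inv w))) <= _).
  apply: prob_le => // w _ _; rewrite /good_word.
  by do 2 case: (tail_at _ _ 0) => //=; rewrite negbK.
apply: le_trans (prob_or _ n0 _ _ _) _.
have -> : n%:R^-1 = n.*2%:R^-1 + n.*2%:R^-1 :> R.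
  have nn : n%:R != 0 :> R by rewrite pnatr_eq0 -lt0n.
  by rewrite -mul2n natrM; field; rewrite nn.
rewrite -addrA; apply: lerD; first exact: prob_tail_at0.
apply: le_trans (prob_or _ n0 _ _ _) _; apply: lerD.
  rewrite (prob_inv _ m (fun w => tail_at (i, false) w 0)).
  exact: prob_tail_at0.
exact: prob_self_collide.
Qed.

Lemma mean_cross_collide (i j : 'I_n) m m' : i != j ->
  mean m (fun w => prob m' (cross_collide i j w)) <=
  4 * (3 / (n.*2%:R * D * (D - 1))).
Proof.
move=> ij; set c := 3 / _.
pose F b b' w := prob m' (fun w' => collide (i, b) (j, b') (end_word b w) (end_word b' w')).
have FE b b' : mean m (F b b') <= c.
  have E w : F b b' w = prob m' (collide (i, b) (j, b') (end_word b w)).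
    by rewrite /F; case: b' {F} => //=; rewrite (prob_inv _ m' (collide _ _ _)).
  apply: le_trans (_ : mean m (fun w => prob m' (collide (i, b) (j, b') w)) <= _).
    apply: le_trans (_ : mean m (fun w => prob m' (collide (i, b) (j, b') (end_word b w))) <= _).
      by apply: mean_le => // w _ _; rewrite E.
    by case: b {F E} => //=; rewrite (mean_inv m (fun w => prob m' (collide _ _ w))).
  by apply: mean_collide => //; rewrite xpair_eqE (negbTE ij).
apply: le_trans (_ : mean m (fun w =>
   (F true true w + F true false w) + (F false true w + F false false w)) <= _).
  apply: mean_le => // w _ _.
  apply: le_trans (_ : prob m' (fun w' =>
    (collide (i, true) (j, true) w w' || collide (i, true) (j, false) w (word_inv w')) ||
    (collide (i, false) (j, true) (word_inv w) w' ||
     collide (i, false) (j, false) (word_inv w) (word_inv w'))) <= _).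
    apply: prob_le => // w' _ _ /existsP[[] /existsP[[] /= ->]]; rewrite ?orbT//.
  apply: le_trans (prob_or _ n0 _ _ _) _; apply: lerD; exact: prob_or.
rewrite !meanD (_ : 4 * c = (c + c) + (c + c)); last by ring.
by do ! apply: lerD; apply: FE.
Qed.

Lemma count_ball p (P : pred (seq (letter n))) :
  count P (ball_words n p) = (\sum_(m <- iota 0 p.+1) count P (rwords n m))%N.
Proof. by rewrite count_flatten sumnE !big_map. Qed.

Lemma size_ball p :
  size (ball_words n p) = (\sum_(m <- iota 0 p.+1) size (rwords n m))%N.
Proof. by rewrite -count_predT count_ball; apply: eq_bigr => m _; rewrite count_predT. Qed.

Lemma count_good_ball i p :
  (1 - (n%:R^-1 + 2 / (D * (D - 1)))) * (size (ball_words n p))%:R <=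
  (count (good_word i) (ball_words n p))%:R :> R.
Proof.
rewrite mulrBl mul1r lerBlDr -lerBlDl -natrB ?count_size//.
have -> : (size (ball_words n p) - count (good_word i) (ball_words n p) =
    count (predC (good_word i)) (ball_words n p))%N.
  by rewrite -(count_predC (good_word i)) addKn.
rewrite count_ball size_ball !natr_sum mulr_sumr.
apply: ler_sum => m _; rewrite -ler_pdivrMr ?nwords_gt0//.
exact: prob_bad_word.
Qed.

Lemma count_cross_ball (i j : 'I_n) p : i != j ->
  (\sum_(w <- ball_words n p) count (cross_collide i j w) (ball_words n p))%N%:R <=
  4 * (3 / (n.*2%:R * D * (D - 1))) * (size (ball_words n p))%:R ^+ 2 :> R.
Proof.
move=> ij; rewrite big_flatten big_map natr_sum size_ball expr2 mulrA.
rewrite {1}natr_sum mulr_sumr mulr_suml; apply: ler_sum => m _.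
have -> : (\sum_(w <- rwords n m) count (cross_collide i j w) (ball_words n p) =
   \sum_(m' <- iota 0 p.+1) \sum_(w <- rwords n m) count (cross_collide i j w) (rwords n m'))%N.
  by rewrite exchange_big; apply: eq_bigr => w _; rewrite count_ball.
rewrite !natr_sum mulr_sumr; apply: ler_sum => m' _.
have N0 k := nwords_gt0 R n0 k.
rewrite -ler_pdivrMr// -ler_pdivrMr//.
apply: le_trans (mean_cross_collide m m' ij); rewrite le_eqVlt; apply/orP; left.
apply/eqP; rewrite /mean; congr (_ / _); rewrite natr_sum mulr_suml.
by apply: eq_bigr => w _; rewrite /prob_words.
Qed.

End BallCounts.

Section BallTuples.
Context (n p : nat).
Notation B := (ball_words n p).

(** Balls are indexed by ordinals so that counting in them becomes counting in a
finite type. *)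
Definition ball_word (x : 'I_(size B)) : seq (letter n) := nth [::] B x.

Lemma ball_wordP x : (size (ball_word x) <= p)%N && reduced (ball_word x).
Proof. by rewrite -mem_ball_words mem_nth. Qed.

Lemma ball_word_inj : injective ball_word.
Proof. by move=> x y /eqP; rewrite nth_uniq ?ball_words_uniq// => /eqP/val_inj. Qed.

Lemma card_ball_word (P : pred (seq (letter n))) :
  #|[pred x | P (ball_word x)]| = count P B.
Proof.
rewrite -sum1_card -sum1_count (big_nth [::]) big_mkord.
by apply: eq_bigl => x; rewrite inE.
Qed.

Lemma card_ball_word2 (P : rel (seq (letter n))) :
  #|[pred xy | P (ball_word xy.1) (ball_word xy.2)]| =
  (\sum_(w <- B) count (P w) B)%N.
Proof.
rewrite (big_nth [::]) big_mkord.
under eq_bigr => x _ do rewrite -card_ball_word -sum1_card.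
by rewrite -sum1_card pair_big_dep /=; apply: eq_bigl => -[x y]; rewrite !inE.
Qed.

Definition ball_tuple (f : {ffun 'I_n -> 'I_(size B)}) : {ffun 'I_n -> free_group n} :=
  [ffun i => of_word (ball_word (f i))].

Lemma ball_tuple_inj : injective ball_tuple.
Proof.
move=> f g fg; apply/ffunP => i; apply: ball_word_inj.
have /andP[_ rf] := ball_wordP (f i); have /andP[_ rg] := ball_wordP (g i).
have := congr1 (fun t : {ffun 'I_n -> free_group n} => fword (t i)) fg.
by rewrite !ffunE !of_wordK.
Qed.

Lemma card_cube_set (S : set {ffun 'I_n -> free_group n}) :
  #|` fset_set (S `&` @cube n p)| = #|[pred f | ball_tuple f \in S]|.
Proof.
have fin : finite_set (S `&` @cube n p).
  by apply: sub_finite_set (@finite_cube n p) => t [].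
have -> : fset_set (S `&` @cube n p) =
    [fset ball_tuple f | f in [pred f | ball_tuple f \in S]]%fset.
  apply/fsetP => t; rewrite in_fset_set//; apply/idP/imfsetP.
    rewrite inE => -[St ct].
    have wB i : fword (t i) \in B by rewrite mem_ball_words fword_reduced andbT; apply: ct.
    have iB i : (index (fword (t i)) B < size B)%N by rewrite index_mem.
    pose f := [ffun i => Ordinal (iB i)].
    have tf : t = ball_tuple f.
      by apply/ffunP => i; rewrite !ffunE /ball_word /= nth_index// fwordK.
    exists f; last exact: tf.
    by rewrite inE -tf.
  move=> [f]; rewrite !inE => fS ->; split=> // i.
  rewrite ffunE; have /andP[fp rf] := ball_wordP (f i).
  by rewrite /Defs.ball /mkset of_wordK.
rewrite card_imfset//; last exact: ball_tuple_inj.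
by rewrite cardE.
Qed.

Lemma card_cube : #|` fset_set (@cube n p)| = (size B ^ n)%N.
Proof.
rewrite -[X in fset_set X]setTI card_cube_set.
transitivity #|{ffun 'I_n -> 'I_(size B)}|; last by rewrite card_ffun !card_ord.
by apply: eq_card => f; rewrite !inE; apply/asboolP.
Qed.

End BallTuples.

(** Every tuple is the tuple of images of the generators under an endomorphism, so
membership is a condition on the tuple only. *)
Lemma wagner_set_of_words n (t : {ffun 'I_n -> free_group n}) :
  (forall i, good_word i (fword (t i))) ->
  (forall i j : 'I_n, (i < j)%N ->
     ~~ cross_collide i j (fword (t i)) (fword (t j))) ->
  @wagner_set n t.
Proof.
move=> good cross; have [phi phiE] := free_group_lift t.
exists phi; last by apply/ffunP => i; rewrite ffunE phiE.
by apply: wagner_all_different_of_words => *; rewrite !phiE; auto.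
Qed.

(** * The lower bound and the product d_n *)

(** The bound q for the proportion of good words, with x in place of n. *)
Definition good_ratio (R : realFieldType) (x : R) : R :=
  1 - x^-1 - ((2 * x - 1) * (x - 1))^-1.

Lemma natr_bin2 (R : realFieldType) n : 'C(n, 2)%:R = n%:R * (n%:R - 1) / 2 :> R.
Proof.
elim: n => [|n IH]; first by rewrite !mul0r.
by rewrite binS bin1 natrD IH -natr1; field.
Qed.

Lemma density_seq_ge (R : realType) n p : (1 < n)%N ->
  let q := good_ratio n%:R : R in let c := 3 / (2 * (2 * n%:R - 1)) in
  0 < q -> c <= q ^+ 2 ->
  q ^+ n * (1 - c / q ^+ 2) <= density_seq R (@wagner_set n) p.
Proof.
move=> n1 q c q0 cq; have n0 := ltnW n1.
have x1 : 1 < n%:R :> R by rewrite ltr1n.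
have xn0 : n%:R != 0 :> R by rewrite pnatr_eq0 -lt0n.
have x1n0 : n%:R - 1 != 0 :> R by rewrite subr_eq0 gt_eqF.
have Dn0 : 2 * n%:R - 1 != 0 :> R by rewrite subr_eq0 gt_eqF//; lra.
have D1n0 : 2 * n%:R - 1 - 1 != 0 :> R.
  by rewrite -addrA -opprD subr_eq0 gt_eqF//; lra.
have dE : n.*2%:R = 2 * n%:R :> R by rewrite -mul2n natrM.
have DE : n.*2.-1%:R = 2 * n%:R - 1 :> R by rewrite -subn1 natrB ?double_gt0// dE.
pose b : R := 4 * (3 / (n.*2%:R * n.*2.-1%:R * (n.*2.-1%:R - 1))).
have bE : 'C(n, 2)%:R * b = c.
  rewrite natr_bin2 /b /c dE DE; field.
  by rewrite xn0 Dn0 D1n0.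
have qE : q = 1 - (n%:R^-1 + 2 / (n.*2.-1%:R * (n.*2.-1%:R - 1))).
  rewrite /q /good_ratio DE; field.
  by rewrite xn0 x1n0 Dn0 D1n0.
have b0 : 0 <= b.
  by rewrite /b !mulr_ge0// invr_ge0 !mulr_ge0 ?ler0n// DE; lra.
set B := ball_words n p; have B0 : (0 < size B)%N.
  have : [::] \in B by rewrite mem_ball_words.
  by case: (B).
have := @product_union_bound R n 'I_(size B) (fun i x => good_word i (ball_word x))
  (fun i j x y => cross_collide i j (ball_word x) (ball_word y)) q b q0 b0.
rewrite card_ord bE => /(_ B0) bound.
rewrite /density_seq card_cube_set card_cube natrX ler_pdivlMr; last first.
  by rewrite exprn_gt0// ltr0n.
apply: le_trans (bound _ _ cq) _.
- move=> i; rewrite (card_ball_word p (good_word i)) qE.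
  exact: count_good_ball.
- move=> i j ij; rewrite (card_ball_word2 p (cross_collide i j)).
  by apply: count_cross_ball; rewrite // neq_ltn ij.
rewrite ler_nat; apply/subset_leq_card/fintype.subsetP => f.
rewrite !inE => /andP[/forallP good /forallP cross]; apply: wagner_set_of_words.
  move=> i; rewrite ffunE of_wordK; first exact: good.
  by have /andP[] := ball_wordP (f i).
move=> i j ij; rewrite !ffunE !of_wordK.
- by have /forallP/(_ j) := cross i; rewrite ij.
- by have /andP[] := ball_wordP (f j).
- by have /andP[] := ball_wordP (f i).
Qed.

Definition density_factor (R : realFieldType) (x k : R) : R :=
  (4 * (x - 1) ^+ 4 - (8 * k - 6) * (x - 1) ^+ 2 + 4 * k ^+ 2 - 6 * k + 2)
  / (x * (x - 1) * (2 * x - 1) ^+ 2).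

(** The k-th factor is largest for k = 1. After division by a common positive factor,
what remains of the second inequality is x^2 - 3 x + 1 >= 0. *)
Lemma density_factor_le (R : realFieldType) (x k : R) : 3 <= x -> 1 <= k <= x ->
  0 <= density_factor x k <= (1 - x^-1) * good_ratio x.
Proof.
move=> x3 /andP[k1 kx].
pose M := 2 * (x - 1) ^+ 2.
(* The numerator, a quadratic polynomial in k, splits. *)
have numE : 4 * (x - 1) ^+ 4 - (8 * k - 6) * (x - 1) ^+ 2 + 4 * k ^+ 2 - 6 * k + 2 =
    (M - 2 * k + 2) * (M - 2 * k + 1) by rewrite /M; ring.
have M0 : 0 <= M - 2 * k + 1.
  have : 0 <= (x - 3) * x by rewrite mulr_ge0; lra.
  rewrite /M; nra.
have den0 : 0 < x * (x - 1) * (2 * x - 1) ^+ 2.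
  by rewrite !mulr_gt0 ?exprn_gt0//; lra.
rewrite /density_factor numE; apply/andP; split.
  by rewrite divr_ge0 ?(ltW den0)// mulr_ge0//; lra.
rewrite ler_pdivrMr//; apply: le_trans (_ : M * (M - 1) <= _).
  by apply: ler_pM; lra.
have -> : (1 - x^-1) * good_ratio x * (x * (x - 1) * (2 * x - 1) ^+ 2) =
    M * (M - 1) + (x - 1) * ((x - 3) * x + 1) / x.
  rewrite /good_ratio /M; field.
  by rewrite !(subr_eq0, gt_eqF)//; lra.
  have x30 : 0 <= (x - 3) * x by rewrite mulr_ge0; lra.
by rewrite lerDl; apply: divr_ge0; [apply: mulr_ge0|]; lra.
Qed.

Lemma bernoulli (R : realFieldType) (h : R) n : 0 <= h -> 1 + n%:R * h <= (1 + h) ^+ n.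
Proof.
move=> h0; elim: n => [|n IH]; first by rewrite mul0r addr0 expr0.
rewrite exprS; apply: le_trans (ler_wpM2l _ IH); last by lra.
have : 0 <= n%:R * h * h by rewrite !mulr_ge0.
rewrite -natr1; lra.
Qed.

Lemma expr_1Bn_le_half (R : realFieldType) n : (1 < n)%N ->
  (1 - n%:R^-1) ^+ n <= 2^-1 :> R.
Proof.
move=> n1; have x1 : 1 < n%:R :> R by rewrite ltr1n.
pose h : R := (n%:R - 1)^-1; have h0 : 0 < h by rewrite invr_gt0 subr_gt0.
have -> : 1 - n%:R^-1 = (1 + h)^-1.
  rewrite /h; field.
  by rewrite !(subr_eq0, gt_eqF)//; lra.
rewrite exprVn lef_pV2 ?posrE ?exprn_gt0//; try lra.
apply: le_trans (bernoulli n (ltW h0)).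
have : 1 <= n%:R * h by rewrite /h ler_pdivlMr ?subr_gt0//; lra.
lra.
Qed.

Lemma good_ratio_ge (R : realFieldType) (x : R) : 4 <= x -> 7 / 10 <= good_ratio x.
Proof.
move=> x4; have h1 : x^-1 <= 4^-1 by rewrite lef_pV2 ?posrE//; lra.
have h2 : ((2 * x - 1) * (x - 1))^-1 <= 21^-1.
  rewrite lef_pV2 ?posrE ?mulr_gt0//; try lra.
  apply: le_trans (_ : 7 * 3 <= _); first by lra.
  by apply: ler_pM; lra.
rewrite /good_ratio; lra.
Qed.

(** Rank 3 is treated apart: there c/q^2 is 270/289, so that the estimate
c/q^2 <= 1/2 fails and the factors have to be evaluated. *)
Lemma prod_density_factor_le (R : realFieldType) n : (3 <= n)%N ->
  let q := good_ratio n%:R : R in let c := 3 / (2 * (2 * n%:R - 1)) in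
  [/\ 0 < q, c <= q ^+ 2 &
   \prod_(1 <= k < n.+1) density_factor n%:R k%:R <= q ^+ n * (1 - c / q ^+ 2)].
Proof.
move=> n3 q c; have x3 : 3 <= n%:R :> R by rewrite (ler_nat _ 3).
move: n3; rewrite leq_eqVlt => /predU1P[n3|n4].
  have q3 : good_ratio 3 = 17 / 30 :> R by rewrite /good_ratio; field.
  have c3 : 3 / (2 * (2 * 3 - 1)) = 3 / 10 :> R by field.
  rewrite /q /c -n3 q3 c3; split; [lra|lra|].
  rewrite 3?big_nat_recr//= big_geq// mul1r.
  have -> : density_factor 3 1 = 28 / 75 :> R by rewrite /density_factor; field.
  have -> : density_factor 3 2 = 1 / 5 :> R by rewrite /density_factor; field.
  have -> : density_factor 3 3 = 2 / 25 :> R by rewrite /density_factor; field.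
  have -> : 3 / 10 / (17 / 30) ^+ 2 = 270 / 289 :> R by field.
  lra.
have x4 : 4 <= n%:R :> R by rewrite (ler_nat _ 4).
have q7 : 7 / 10 <= q := good_ratio_ge x4.
have q0 : 0 < q by lra.
have q2 : 49 / 100 <= q ^+ 2.
  by apply: le_trans (_ : (7 / 10) ^+ 2 <= _); [lra|rewrite lerXn2r ?nnegrE//; lra].
have cq : 2 * c <= q ^+ 2.
  apply: le_trans q2; rewrite /c mulrA ler_pdivrMr; lra.
have c0 : 0 <= c by rewrite /c divr_ge0//; lra.
split=> //; first by lra.
apply: le_trans (_ : ((1 - n%:R^-1) * q) ^+ n <= _).
  rewrite -[X in _ ^+ X](subn1 n.+1) -prodr_const_nat.
  rewrite big_nat [leRHS]big_nat; apply: ler_prod => k /andP[k1 kn].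
  by apply: density_factor_le => //; rewrite ler1n k1 ler_nat -ltnS.
rewrite exprMn [leLHS]mulrC ler_wpM2l ?exprn_ge0 ?(ltW q0)//.
apply: le_trans (expr_1Bn_le_half R _) _; first exact: ltnW (ltnW n4).
have : c / q ^+ 2 <= 2^-1 by rewrite ler_pdivrMr ?exprn_gt0//; lra.
lra.
Qed.

Unset Implicit Arguments.

Theorem theorem17 (R : realType) (n : nat) (hn : (2 <= n)%N) :
  cvgn (density_seq R (@wagner_set n)) ->
  \prod_(1 <= k < n.+1)
     ((4 * (n%:R - 1) ^+ 4 - (8 * k%:R - 6) * (n%:R - 1) ^+ 2
        + 4 * k%:R ^+ 2 - 6 * k%:R + 2)
      / (n%:R * (n%:R - 1) * (2 * n%:R - 1) ^+ 2))
  <= asymptotic_density R (@wagner_set n).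
Proof.
move=> cv; apply: limr_ge => //; apply: nearW => p.
move: (hn); rewrite leq_eqVlt => /predU1P[<-|n3].
  (* For n = 2 the factor with k = 2 vanishes. *)
  rewrite [leLHS](_ : _ = 0) ?divr_ge0//.
  by rewrite 2?big_nat_recr//= big_geq//; lra.
have [q0 cq le_d] := prod_density_factor_le R n3.
exact: le_trans le_d (density_seq_ge p hn q0 cq).
Qed.
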